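(* There exist absolute constants $0<c<C$ such that for every $p=p(n)$ with $n^{-1}\le p\le 1-n^{-0.99}$, with probability tending to $1$ as $n\to\infty$ the minimum dimension $d$ such that $G=G(n,p)$ has an orthogonal representation in $\mathbb{R}^d$ satisfies $$c\,\frac{n\log(1/p)}{\log n}\le d\le C\,\frac{n\log(1/p)}{\log n}.$$
   Context: An orthogonal representation of dimension $d$ of a graph $G$ on $[n]$ is an assignment of nonzero vectors $v_1,\dots,v_n\in\mathbb{R}^d$ to the vertices such that $\langle v_i,v_j\rangle=0$ whenever $i\ne j$ are nonadjacent in $G$. $G(n,p)$ denotes the binomial random graph on $[n]$ in which each pair is an edge independently with probability $p$. *)

(* Defs.v *)
From Stdlib Require Import Reals ClassicalEpsilon.
From mathcomp Require Import all_boot.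
Set Implicit Arguments. Unset Strict Implicit. Unset Printing Implicit Defensive.

(* A graph on [n] = 'I_n is encoded by its edge set S, a set of pairs (i,j)
   with i < j.  Vertices i and j are adjacent iff (i,j) or (j,i) is in S. *)
Definition pairs (n : nat) : {set 'I_n * 'I_n} := [set x : 'I_n * 'I_n | (val x.1 < val x.2)%N].

Definition adj (n : nat) (S : {set 'I_n * 'I_n}) (i j : 'I_n) : bool :=
  ((i, j) \in S) || ((j, i) \in S).

Definition dotR (d : nat) (u v : 'I_d -> R) : R :=
  \big[Rplus/R0]_(k < d) (Rmult (u k) (v k)).

Definition orth_rep (n : nat) (S : {set 'I_n * 'I_n}) (d : nat)
    (v : 'I_n -> 'I_d -> R) : Prop :=
  (forall i, exists k, v i k <> R0) /\
  (forall i j, i != j -> ~~ adj S i j -> dotR (v i) (v j) = R0).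

Definition has_orth_rep (n : nat) (S : {set 'I_n * 'I_n}) (d : nat) : Prop :=
  exists v : 'I_n -> 'I_d -> R, @orth_rep n S d v.

Definition min_orth_dim (n : nat) (S : {set 'I_n * 'I_n}) (d : nat) : Prop :=
  has_orth_rep S d /\ (forall d', (d' < d)%N -> ~ has_orth_rep S d').

Definition gnp_prob (n : nat) (p : R) (P : {set 'I_n * 'I_n} -> Prop) : R :=
  \big[Rplus/R0]_(S : {set 'I_n * 'I_n} | S \subset pairs n)
     (if excluded_middle_informative (P S)
      then Rmult (pow p #|S|) (pow (Rminus 1 p) (#|pairs n| - #|S|)%N)
      else R0).

(* Main.v *)
(* Upper bound: a cover of the vertices by k cliques gives an orthogonal
   representation in R^k by standard basis vectors.  Take k of order
   n ln(1/p) / ln n and add the vertices one at a time; given a cover of the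
   earlier vertices, the next one fits into no clique of sizes m_1, ..., m_k with
   probability prod (1 - p^m_j) <= exp (- k p^(n/k)), which is at most n^-2.

   Lower bound: let M = V V^T be the Gram matrix of a representation, and let A
   be a vertex set minimising rk(A) / |A|.  Every row of M[A] has at least
   |A| / rk(A) nonzero entries, and A has a basis B whose rows contain at most
   the share rk(A) / |A| of the nonzero entries of M[A].  The rows B determine
   M[A], and the entries of det(M[B]) M[A] are polynomials of low degree in the t
   nonzero entries of these rows, so that for each position set of these entries
   there are at most n^(4t) possible supports of M[A] (Ronyai, Babai, Ganapathy).
   Each support lies in the random graph with probability at most n^(-16t), and
   the union bound over all position sets finishes the proof. *)
Require Import Defs.
From Stdlib Require Import ZArith Reals Lra.
From mathcomp Require Import all_boot all_order all_algebra perm zify.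
From mathcomp Require Import boolp Rstruct.
Set Implicit Arguments. Unset Strict Implicit. Unset Printing Implicit Defensive.
Import Order.TTheory GRing.Theory Num.Theory.
Local Open Scope ring_scope.

(** * Random subsets *)

(** A subset of a disjoint union is determined by its traces on the two parts; this bijection is the
    source of the independence used below. *)
Lemma sum_subsetU (R : nmodType) (T : finType) (E1 E2 : {set T}) (F : {set T} -> R) :
  [disjoint E1 & E2] ->
  \sum_(S : {set T} | S \subset E1 :|: E2) F S =
  \sum_(S1 : {set T} | S1 \subset E1) \sum_(S2 : {set T} | S2 \subset E2) F (S1 :|: S2).
Proof.
move=> dE; rewrite pair_big /=.
rewrite (reindex_onto (fun x : {set T} * {set T} => x.1 :|: x.2)
  (fun S => (S :&: E1, S :&: E2))) /=; last first.
  by move=> S sS; rewrite -setIUr; apply/setIidPl.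
apply: eq_bigl => -[S1 S2] /=; rewrite xpair_eqE; apply/andP/andP.
  by move=> [_ /andP[/eqP<- /eqP<-]]; rewrite !subsetIr.
move=> [s1 s2]; split; first exact: setUSS.
have d12 : S2 :&: E1 = set0.
  by apply/disjoint_setI0; rewrite disjoint_sym (disjointWr s2).
have d21 : S1 :&: E2 = set0 by apply/disjoint_setI0/(disjointWl s1).
rewrite !setIUl d12 d21 setU0 set0U.
by apply/andP; split; apply/eqP/setIidPl.
Qed.

(** The binomial theorem indexed by subsets. It gives total mass 1 in [expect_cst] and sums the
    union bound over position sets in [expect_small_orth_rep]. *)
Lemma sum_subset_pow (R : comNzRingType) (T : finType) (E : {set T}) (x y : R) :
  \sum_(S : {set T} | S \subset E) x ^+ #|S| * y ^+ (#|E| - #|S|) = (x + y) ^+ #|E|.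
Proof.
move: {2}#|E| (erefl #|E|) => m; elim: m E => [|m IHm] E cE.
  have /eqP-> : E == set0 by rewrite -cards_eq0 cE.
  by rewrite (big_pred1 set0) ?cards0 ?mulr1 // => S; rewrite subset0.
have [e eE] : exists e, e \in E by apply/set0Pn; rewrite -cards_eq0 cE.
have cE' : #|E :\ e| = m by move: cE; rewrite (cardsD1 e) eE => -[].
rewrite -{1}(setD1K eE) sum_subsetU; last by rewrite disjoints1 !inE eqxx.
have D (S : {set T}) : S \subset E :\ e -> e \notin S.
  by move=> sS; apply/negP => /(subsetP sS); rewrite !inE eqxx.
rewrite (bigD1 [set e]) //= [X in _ + X](big_pred1 set0) => [|S]; last first.
  rewrite subset1; case: eqVneq => [->|_]; rewrite ?orbF /=.
    by apply/esym/negbTE/set0Pn; exists e; rewrite inE.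
  by rewrite andbT.
rewrite cE exprS mulrDl -cE' -IHm // !mulr_sumr; congr (_ + _).
  apply: eq_bigr => S sS; rewrite cardsU1 D // add1n cE' subSS exprS mulrA //.
apply: eq_bigr => S sS; rewrite set0U cE' subSn ?exprS; first by rewrite mulrCA.
by rewrite -cE' subset_leq_card.
Qed.

Section RandomSubset.
Variables (R : numDomainType) (T : finType) (p : R).

(** For [E = pairs n] this is the mean over the random graph; a variable [E] allows the pairs to be
    exposed in stages. *)
Definition expect (E : {set T}) (f : {set T} -> R) : R :=
  \sum_(S : {set T} | S \subset E) p ^+ #|S| * (1 - p) ^+ (#|E| - #|S|) * f S.

Lemma expectU (E1 E2 : {set T}) f : [disjoint E1 & E2] ->
  expect (E1 :|: E2) f = expect E1 (fun S1 => expect E2 (fun S2 => f (S1 :|: S2))).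
Proof.
move=> dE; rewrite /expect sum_subsetU //; apply: eq_bigr => S1 s1.
rewrite mulr_sumr; apply: eq_bigr => S2 s2.
have cU (A B : {set T}) : [disjoint A & B] -> #|A :|: B| = (#|A| + #|B|)%N.
  by move=> dAB; rewrite cardsU disjoint_setI0 // cards0 subn0.
rewrite !cU //; last exact: disjointW dE.
have -> : (#|E1| + #|E2| - (#|S1| + #|S2|) = (#|E1| - #|S1|) + (#|E2| - #|S2|))%N.
  by rewrite subnDA addnC -addnBA ?subset_leq_card // addnC -addnBA ?subset_leq_card.
by rewrite !exprD !mulrA; congr (_ * _ * _); rewrite mulrAC.
Qed.

Lemma eq_expect (E : {set T}) f g : (forall S : {set T}, S \subset E -> f S = g S) ->
  expect E f = expect E g.
Proof. by move=> fg; apply: eq_bigr => S /fg->. Qed.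

Lemma expect_cst E (c : R) : expect E (fun=> c) = c.
Proof. by rewrite /expect -mulr_suml sum_subset_pow subrKC expr1n mul1r. Qed.

Lemma expectZ E (c : R) f : expect E (fun S => c * f S) = c * expect E f.
Proof. by rewrite /expect mulr_sumr; apply: eq_bigr => S _; rewrite mulrCA. Qed.

Lemma expectB E f g : expect E (fun S => f S - g S) = expect E f - expect E g.
Proof. by rewrite /expect -sumrB; apply: eq_bigr => S _; rewrite mulrBr. Qed.

Lemma expectD E f g : expect E (fun S => f S + g S) = expect E f + expect E g.
Proof. by rewrite /expect -big_split; apply: eq_bigr => S _; rewrite mulrDr. Qed.

Lemma expect_sum (I : Type) (r : seq I) (P : pred I) E (f : I -> {set T} -> R) :
  expect E (fun S => \sum_(i <- r | P i) f i S) = \sum_(i <- r | P i) expect E (f i).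
Proof. by rewrite /expect exchange_big; apply: eq_bigr => S _; rewrite mulr_sumr. Qed.

Lemma expect_sub (F : {set T}) : expect F (fun S => (F \subset S)%:R) = p ^+ #|F|.
Proof.
rewrite /expect (bigD1 F) //= subxx subnn expr0 !mulr1 big1 ?addr0 // => S.
by case/andP=> sSF; rewrite eqEsubset sSF /= => /negbTE->; rewrite mulr0.
Qed.

(** Distinct fibres are disjoint, so the events of containing them are independent. The induction
    exposes the fibre of the first value [j]; the other fibres lie in [E :\: F]. *)
Lemma expect_fibres (J : eqType) (c : T -> J) (r : seq J) (E : {set T}) :
  uniq r -> (forall x, x \in E -> c x \in r) ->
  expect E (fun S => \prod_(j <- r) (1 - ([set x in E | c x == j] \subset S)%:R)) =
  \prod_(j <- r) (1 - p ^+ #|[set x in E | c x == j]|).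
Proof.
elim: r E => [|j r IHr] E; first by move=> _ _; rewrite big_nil -[RHS](expect_cst E);
  apply: eq_expect => S _; rewrite big_nil.
move=> /= /andP[jr ur] cE; pose F := [set x in E | c x == j].
have sFE : F \subset E by apply/subsetP=> x; rewrite inE => /andP[].
have dF : [disjoint F & E :\: F] by rewrite disjoint_sym disjoints_subset subsetDr.
have fib i : i \in r -> [set x in E :\: F | c x == i] = [set x in E | c x == i].
  move=> ir; apply/setP=> x; rewrite !inE.
  by case: (eqVneq (c x) i) => [->|_]; rewrite ?andbF // (negbTE (memPn jr _ ir)) andbF.
rewrite -{1}(setID E F) (setIidPr sFE) expectU // big_cons.
transitivity (expect F (fun S1 => (1 - (F \subset S1)%:R) *
   \prod_(i <- r) (1 - p ^+ #|[set x in E | c x == i]|))).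
  apply: eq_expect => S1 s1.
  under eq_big_seq => i ir do rewrite -fib //.
  rewrite -IHr //; last first.
    move=> x; rewrite !inE => /andP[nxF xE]; move: (cE x xE); rewrite inE.
    by rewrite xE /= in nxF; rewrite (negbTE nxF).
  rewrite -expectZ; apply: eq_expect => S2 s2; rewrite big_cons; congr (_ * _).
    congr (1 - (nat_of_bool _)%:R); apply/idP/idP => [/subsetP sF|]; last first.
      by move/subset_trans; apply; apply: subsetUl.
    apply/subsetP=> x xF; move: (sF x xF); rewrite inE => /orP[//|/(subsetP s2)].
    by rewrite inE xF.
  apply: eq_big_seq => i ir; rewrite fib //; congr (1 - (nat_of_bool _)%:R).
  apply/idP/idP => /subsetP sF; last first.
    by apply/subsetP=> x /sF; rewrite inE orbC => ->.
  apply/subsetP=> x xF; move: (sF x xF); rewrite inE => /orP[/(subsetP s1)|//].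
  move: xF; rewrite !inE => /andP[-> /eqP->] /= /eqP ij.
  by move: jr; rewrite -ij ir.
rewrite (eq_expect (g := fun S1 => (\prod_(i <- r) (1 - p ^+ #|[set x in E | c x == i]|)) *
  (1 - (F \subset S1)%:R))) => [|S _]; last by rewrite mulrC.
by rewrite expectZ mulrC (expectB F (fun=> 1)) expect_cst expect_sub.
Qed.

Lemma expect_subset (E F : {set T}) : F \subset E ->
  expect E (fun S => (F \subset S)%:R) = p ^+ #|F|.
Proof.
move=> sFE.
have dF : [disjoint F & E :\: F] by rewrite disjoint_sym disjoints_subset subsetDr.
rewrite -{1}(setID E F) (setIidPr sFE) expectU // -expect_sub.
apply: eq_expect => S1 s1; rewrite -[RHS](expect_cst (E :\: F)).
apply: eq_expect => S2 s2; congr (nat_of_bool _)%:R.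
apply/idP/idP => [/subsetP sF|]; last by move/subset_trans; apply; apply: subsetUl.
apply/subsetP=> x xF; move: (sF x xF); rewrite inE => /orP[//|/(subsetP s2)].
by rewrite inE xF.
Qed.

Hypothesis p01 : 0 <= p <= 1.

Lemma ler_expect (E : {set T}) f g : (forall S : {set T}, S \subset E -> f S <= g S) ->
  expect E f <= expect E g.
Proof.
move=> fg; apply: ler_sum => S /fg; apply: ler_wpM2l.
by case/andP: p01 => p0 p1; rewrite mulr_ge0 // exprn_ge0 ?subr_ge0.
Qed.

Lemma expect_exists_subset (E : {set T}) (P : {set {set T}}) :
  (forall H, H \in P -> H \subset E) ->
  expect E (fun S => [exists H in P, H \subset S]%:R) <= \sum_(H in P) p ^+ #|H|.
Proof.
move=> PE; under eq_bigr => H /PE HE do rewrite -(expect_subset HE).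
rewrite -expect_sum; apply: ler_expect => // S _.
case: existsP => [[H /andP[HP HS]]|_]; last by apply: sumr_ge0.
by rewrite (bigD1 H) //= HS lerDl; apply: sumr_ge0.
Qed.

End RandomSubset.

(** * Random clique covers *)

(** All vertices carry a colour but only those below [i] are constrained, so that every stage of the
    vertex-by-vertex construction uses the same type. *)
Definition clique_coloring (n k i : nat) (S : {set 'I_n * 'I_n}) (c : {ffun 'I_n -> 'I_k}) :=
  [forall u : 'I_n, forall v : 'I_n, (u < v < i)%N && (c u == c v) ==> ((u, v) \in S)].

Definition clique_colorable (n k i : nat) (S : {set 'I_n * 'I_n}) :=
  [exists c : {ffun 'I_n -> 'I_k}, clique_coloring i S c].

Lemma clique_coloringP n k i (S : {set 'I_n * 'I_n}) (c : {ffun 'I_n -> 'I_k}) :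
  reflect (forall u v : 'I_n, (u < v < i)%N -> c u = c v -> (u, v) \in S)
    (clique_coloring i S c).
Proof.
apply: (iffP forallP) => [h u v uv /eqP cuv|h u].
  by have /forallP/(_ v)/implyP := h u; rewrite uv cuv; apply.
by apply/forallP=> v; apply/implyP=> /andP[uv /eqP cuv]; apply: h.
Qed.

Section CliqueColoring.
Variables (R : numDomainType) (p : R) (p01 : 0 <= p <= 1) (n k : nat) (beta : R).
Hypothesis beta_ge0 : 0 <= beta.
(** With [F j] the size of the [j]-th clique, [beta] bounds the chance that a new vertex is
    completely joined to none of them. *)
Hypothesis betaP : forall F : 'I_k -> nat, (\sum_j F j <= n)%N ->
  \prod_j (1 - p ^+ F j) <= beta.

(* Vertex [i] fails to extend a colouring of the earlier vertices only if it is
   not completely joined to any colour class; these events involve disjoint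
   sets of pairs. *)
Lemma expect_coloring_step (i : 'I_n) :
  expect p (pairs n)
    (fun S => (clique_colorable k i S && ~~ clique_colorable k i.+1 S)%:R) <= beta.
Proof.
(* The pairs joining [i] to smaller vertices; colourings of the vertices below [i] never consult
   them. *)
pose St := [set x in pairs n | x.2 == i].
have sSt : St \subset pairs n by apply/subsetP=> x; rewrite inE => /andP[].
have dSt : [disjoint pairs n :\: St & St] by rewrite disjoints_subset subsetDr.
rewrite -(setID (pairs n) St) (setIidPr sSt) setUC expectU //.
rewrite -[leRHS](expect_cst p (pairs n :\: St)).
apply: ler_expect => // S1 s1.
have [|noc] := boolP (clique_colorable k i S1); last first.
  rewrite (eq_expect p (g := fun=> 0)) ?expect_cst // => S2 s2.
  suff -> : clique_colorable k i (S1 :|: S2) = false by [].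
  apply/negbTE; move: noc; apply: contra => /existsP[c /clique_coloringP h].
  apply/existsP; exists c; apply/clique_coloringP => u v uv cuv.
  have := h u v uv cuv; rewrite inE => /orP[//|/(subsetP s2)].
  rewrite inE /= => /andP[_ /eqP vi].
  by move: uv; rewrite vi ltnn andbF.
move=> /existsP[c /clique_coloringP cP].
(* The pairs joining [i] to the earlier vertices of colour [j]; if all are present, [i] can take
   colour [j]. *)
pose F j := [set x in St | c x.1 == j].
apply: (@le_trans _ _ (expect p St (fun S2 => \prod_j (1 - (F j \subset S2)%:R)))).
  apply: ler_expect => // S2 s2.
  have pge0 : 0 <= \prod_j (1 - (F j \subset S2)%:R : R).
    by apply: prodr_ge0 => j _; case: (_ \subset _); rewrite ?subrr // subr0.
  have [/andP[_ nQ]|//] := boolP (_ && _).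
  rewrite big1 // => j _; case: (boolP (F j \subset S2)) => [sF|_]; last by rewrite subr0.
  case/existsP: nQ; exists [ffun u => if u == i then j else c u].
  apply/clique_coloringP => u v /andP[uv vi]; rewrite !ffunE inE.
  have ui : u != i by apply: contraTneq vi => <-; rewrite ltnS -ltnNge.
  rewrite (negbTE ui); case: eqVneq => [vE cuj|nvi cuv].
    apply/orP; right; apply: (subsetP sF); rewrite !inE /= vE cuj !eqxx -vE.
    by rewrite /= uv.
  apply/orP; left; apply: cP => //; rewrite uv /=.
  by rewrite ltn_neqAle nvi -ltnS.
rewrite (@expect_fibres _ _ p _ (fun x => c x.1)); last 2 first.
- exact: index_enum_uniq.
- by move=> x _; rewrite mem_index_enum.
apply: (betaP (F := fun j => #|[set x in St | c x.1 == j]|)).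
have -> : (\sum_j #|[set x in St | c x.1 == j]| = #|St|)%N.
  rewrite -sum1_card (partition_big (fun x => c x.1) xpredT) //=.
  apply: eq_bigr => j _; rewrite -sum1_card; apply: eq_bigl => x; by rewrite inE.
rewrite -[leqRHS](card_ord n) -cardsT.
apply: leq_trans (leq_imset_card (fun u => (u, i)) _).
apply/subset_leq_card/subsetP=> -[u v]; rewrite inE /= => /andP[_ /eqP->].
by apply/imsetP; exists u.
Qed.

(** If no colouring reaches stage [n], some stage fails first, and each stage does so with
    probability at most [beta]. *)
Lemma expect_not_colorable :
  expect p (pairs n) (fun S => (~~ clique_colorable k n S)%:R) <= beta *+ n.
Proof.
(* With no colours the empty product forces [1 <= beta], and the bound is trivial unless [n = 0],
   where the empty colouring works. *)
have [k0|k_gt0] := posnP k.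
  have b1 : 1 <= beta.
    have -> : 1 = \prod_(j < k) (1 - p ^+ 0) :> R.
      by rewrite big1_seq // => j _; move: (ltn_ord j); rewrite {2}k0.
    by apply: (betaP (F := fun=> 0%N)); rewrite big1.
  have [n0|n_gt0] := posnP n.
    rewrite (eq_expect p (g := fun=> 0)) ?expect_cst ?mulrn_wge0 // => S _.
    have n0F (u : 'I_n) : False by move: (ltn_ord u); rewrite {2}n0.
    suff -> : clique_colorable k n S by [].
    apply/existsP; exists [ffun u => match n0F u with end].
    by apply/clique_coloringP => u; case: (n0F u).
  apply: (@le_trans _ _ 1).
    rewrite -[leRHS](expect_cst p (pairs n)); apply: ler_expect => // S _.
    by case: (clique_colorable _ _ _); rewrite ?lexx ?ler01.
  by rewrite -(prednK n_gt0) mulrS; apply: (le_trans b1); rewrite lerDl mulrn_wge0.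
apply: (@le_trans _ _ (\sum_(i < n) expect p (pairs n)
    (fun S => (clique_colorable k i S && ~~ clique_colorable k i.+1 S)%:R))); last first.
  apply: (@le_trans _ _ (\sum_(i < n) beta)); last by rewrite sumr_const card_ord.
  by apply: ler_sum => i _; apply: expect_coloring_step.
rewrite -expect_sum; apply: ler_expect => // S _.
have Q0 : clique_colorable k 0 S.
  apply/existsP; exists [ffun=> Ordinal k_gt0]; apply/clique_coloringP => u v.
  by rewrite ltn0 andbF.
suff H m : (~~ clique_colorable k m S)%:R <= \sum_(i < m)
    (clique_colorable k i S && ~~ clique_colorable k i.+1 S)%:R :> R by [].
elim: m => [|m IHm]; first by rewrite Q0 big_ord0.
rewrite big_ord_recr /=; case: (clique_colorable k m S) IHm => /= IHm.
  by rewrite lerDr.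
rewrite addr0; apply: le_trans IHm; by case: (clique_colorable _ _ _).
Qed.

End CliqueColoring.

(** * Zero patterns of polynomials *)

Section PolynomialFunctions.
Variables (R : fieldType) (I : finType).
Implicit Types (f g : (I -> R) -> R) (x : I -> R) (d : nat).

(** The degree is bounded in each variable separately, so that there are exactly [d.+1 ^ #|I|]
    monomials. *)
Definition poly_fun d f : Prop :=
  exists c : {ffun I -> 'I_d.+1} -> R,
    forall x, f x = \sum_e c e * \prod_i x i ^+ e i.

Lemma eq_poly_fun d f g : f =1 g -> poly_fun d f -> poly_fun d g.
Proof. by move=> fg [c fc]; exists c => x; rewrite -fg. Qed.

Lemma poly_fun_monomial d (a : R) (m : I -> nat) : (forall i, m i <= d)%N ->
  poly_fun d (fun x => a * \prod_i x i ^+ m i).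
Proof.
move=> md; pose e0 : {ffun I -> 'I_d.+1} := [ffun i => inord (m i)].
exists (fun e => if e == e0 then a else 0) => x.
rewrite (bigD1 e0) //= eqxx [X in _ + X]big1 ?addr0 => [|e /negbTE->]; last by rewrite mul0r.
by congr (_ * _); apply: eq_bigr => i _; rewrite ffunE inordK ?ltnS.
Qed.

Lemma poly_fun_sum d (J : Type) (r : seq J) (P : pred J) (f : J -> (I -> R) -> R) :
  (forall j, P j -> poly_fun d (f j)) -> poly_fun d (fun x => \sum_(j <- r | P j) f j x).
Proof.
move=> Pf; elim: r => [|j r [c IHc]].
  by exists (fun=> 0) => x; rewrite big_nil big1 // => e _; rewrite mul0r.
have [Pj|/negbTE nPj] := boolP (P j); last by exists c => x; rewrite big_cons nPj.
have [c' Hc'] := Pf j Pj.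
exists (fun e => c' e + c e) => x; rewrite big_cons Pj.
by rewrite Hc' IHc -big_split; apply: eq_bigr => e _; rewrite mulrDl.
Qed.

Lemma poly_fun_leq d d' f : (d <= d')%N -> poly_fun d f -> poly_fun d' f.
Proof.
move=> dd' [c fc].
apply: (@eq_poly_fun d' (fun x => \sum_e c e * \prod_i x i ^+ (e i : nat))) => [x|].
  by rewrite fc.
apply: poly_fun_sum => e _; apply: poly_fun_monomial => i.
by apply: leq_trans dd'; rewrite -ltnS.
Qed.

Lemma poly_fun_cst d (a : R) : poly_fun d (fun=> a).
Proof.
apply: (@eq_poly_fun d (fun x => a * \prod_i x i ^+ 0)) => [x|].
  by rewrite big1 ?mulr1.
exact: poly_fun_monomial.
Qed.

Lemma poly_fun_var (i : I) : poly_fun 1 (fun x => x i).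
Proof.
apply: (@eq_poly_fun 1 (fun x => 1 * \prod_j x j ^+ (j == i))) => [x|].
  rewrite mul1r (bigD1 i) //= eqxx big1 ?mulr1 // => j /negbTE->.
  exact: expr0.
by apply: poly_fun_monomial => j; case: eqP.
Qed.

Lemma poly_funM d1 d2 f g : poly_fun d1 f -> poly_fun d2 g ->
  poly_fun (d1 + d2) (fun x => f x * g x).
Proof.
move=> [a fa] [b gb].
apply: (@eq_poly_fun (d1 + d2) (fun x => \sum_e1 \sum_e2
   (a e1 * b e2) * \prod_i x i ^+ ((e1 i : nat) + (e2 i : nat)))) => [x|].
  rewrite fa gb mulr_suml; apply: eq_bigr => e1 _.
  rewrite mulr_sumr; apply: eq_bigr => e2 _.
  rewrite mulrACA; congr (_ * _); rewrite -big_split.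
  by apply: eq_bigr => i _; rewrite exprD.
apply: poly_fun_sum => e1 _; apply: poly_fun_sum => e2 _.
by apply: poly_fun_monomial => i; rewrite leq_add // -ltnS.
Qed.

Lemma poly_fun_prod d (J : finType) (A : {set J}) (f : J -> (I -> R) -> R) :
  (forall j, poly_fun d (f j)) -> poly_fun (d * #|A|) (fun x => \prod_(j in A) f j x).
Proof.
move=> Pf; rewrite cardE.
apply: (@eq_poly_fun _ (fun x => \prod_(j <- enum A) f j x)) => [x|].
  by rewrite big_enum.
elim: (enum A) => [|j r IHr] /=.
  by apply: eq_poly_fun (poly_fun_cst _ 1) => x; rewrite big_nil.
rewrite mulnS; apply: eq_poly_fun (poly_funM (Pf j) IHr) => x.
by rewrite big_cons.
Qed.

(* For patterns [H] realised at [u H], the products [g_H] of the [f j] with [j]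
   in [H] satisfy [g_H (u H') != 0] iff [H \subset H'], hence are linearly
   independent. *)
Lemma card_zero_patterns (J : finType) d (f : J -> (I -> R) -> R)
    (P : {set {set J}}) :
  (forall j, poly_fun d (f j)) ->
  (forall H, H \in P -> exists x, H = [set j | f j x != 0]) ->
  (#|P| <= (d * #|J|).+1 ^ #|I|)%N.
Proof.
move=> Pf /= PP.
have /fin_all_exists[u uP] : forall H, exists x, H \in P -> H = [set j | f j x != 0].
  move=> H; have [/PP[x ->]|_] := boolP (H \in P); first by exists x.
  by exists (fun=> 0).
pose g (H : {set J}) x := \prod_(j in H) f j x.
have g0 H H' : H' \in P -> (g H (u H') != 0) = (H \subset H').
  move=> /uP H'E; apply/prodf_neq0/subsetP => h j /h.
    by rewrite {2}H'E inE.
  by rewrite {1}H'E inE.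
have /fin_all_exists[c cP] : forall H, exists c : {ffun I -> 'I_(d * #|J|).+1} -> R,
    forall x, g H x = \sum_e c e * \prod_i x i ^+ e i.
  by move=> H; apply: (poly_fun_leq _ (poly_fun_prod H Pf)); rewrite leq_mul2l max_card orbT.
pose K := #|{ffun I -> 'I_(d * #|J|).+1}|.
have -> : ((d * #|J|).+1 ^ #|I|)%N = K by rewrite /K card_ffun card_ord.
(* The matrix of the values [g_H (u H')] factors through the [K] monomials, so its rank is at most
   [K]. *)
pose C := \matrix_(a < #|P|, e < K) c (enum_val a) (enum_val e).
pose E := \matrix_(e < K, b < #|P|)
  \prod_i u (enum_val b) i ^+ (enum_val e : {ffun I -> 'I_(d * #|J|).+1}) i.
have CE a b : (C *m E) a b = g (enum_val a) (u (enum_val b)).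
  rewrite !mxE cP [RHS](reindex (@enum_val _ {: {ffun I -> 'I_(d * #|J|).+1}})) /=.
    by apply: eq_bigr => e _; rewrite !mxE.
  exact: onW_bij (enum_val_bij _).
suff /eqP fG : row_free (C *m E).
  by rewrite -[leqLHS]fG; apply: leq_trans (mxrankM_maxl _ _) (rank_leq_col _).
(* Coefficients vanish by induction on the size of the pattern: in the column of [a] only subsets of
   [a] contribute, and the proper ones are already killed. *)
apply: inj_row_free => v vG0; apply/rowP => a; rewrite [RHS]mxE.
have [m] := ubnP #|enum_val a|; elim: m a => // m IHm a am.
have /rowP/(_ a) := vG0; rewrite mxE (bigD1 a) //= big1 ?addr0 => [|b ba]; last first.
  rewrite CE; have [|] := boolP (enum_val b \subset enum_val a); last first.
    by rewrite -g0 ?enum_valP // negbK => /eqP->; rewrite mulr0.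
  rewrite subEproper (inj_eq enum_val_inj) (negbTE ba) /= => /proper_card lt_ba.
  by rewrite IHm ?mul0r // (leq_trans lt_ba).
rewrite CE mxE => /eqP; rewrite mulf_eq0 => /orP[/eqP//|].
by apply: contraTeq => _; rewrite g0 ?enum_valP.
Qed.

End PolynomialFunctions.

(** * Light bases and Gram matrices *)

Section SparseBasis.
Variables (R : realFieldType) (n d : nat) (V : 'M[R]_(n, d)).
Implicit Types (A B : {set 'I_n}).

(** The coordinate projection onto [A]: restricting by multiplication keeps the matrix sizes fixed
    and avoids reindexing by [A]. *)
Definition mask A : 'M[R]_n := diag_mx (\row_i (i \in A)%:R).

Definition rk A := \rank (mask A *m V).

Lemma mul_mask m A (W : 'M_(n, m)) : mask A *m W = \matrix_(i, j) ((i \in A)%:R * W i j).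
Proof. by rewrite mul_diag_mx; apply/matrixP => i j; rewrite !mxE. Qed.

Lemma mul_mx_mask m A (W : 'M_(m, n)) : W *m mask A = \matrix_(i, j) (W i j * (j \in A)%:R).
Proof. by rewrite mul_mx_diag; apply/matrixP => i j; rewrite !mxE. Qed.

Lemma maskI A B : mask A *m mask B = mask (A :&: B).
Proof.
rewrite mul_mask; apply/matrixP => i j; rewrite !mxE inE.
by case: (i \in A); rewrite ?mul0r ?mul1r ?mul0rn.
Qed.

Lemma mask_subset A B : A \subset B -> mask A *m mask B = mask A.
Proof. by move=> /setIidPl AB; rewrite maskI AB. Qed.

Lemma rank_mask A : (\rank (mask A) <= #|A|)%N.
Proof.
pose C := \matrix_(i < n, a < #|A|) (i == enum_val a)%:R : 'M[R]_(n, #|A|).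
suff -> : mask A = C *m C^T by apply: leq_trans (mxrankM_maxl _ _) (rank_leq_col _).
apply/matrixP => i j; rewrite !mxE.
have [iA|niA] := boolP (i \in A); last first.
  rewrite mul0rn big1 // => a _; rewrite !mxE; case: eqP => [iE|]; last by rewrite mul0r.
  by move: niA; rewrite iE enum_valP.
rewrite (bigD1 (enum_rank_in iA i)) //= !mxE enum_rankK_in // eqxx mul1r eq_sym.
rewrite big1 ?addr0 // => a ai; rewrite !mxE; case: eqP => [iE|]; last by rewrite mul0r.
by case/eqP: ai; apply: enum_val_inj; rewrite enum_rankK_in.
Qed.

Lemma rk_leq_card A : (rk A <= #|A|)%N.
Proof. exact: leq_trans (mxrankM_maxl _ _) (rank_mask A). Qed.

Lemma row_mask_sub A a : a \in A -> (row a V <= mask A *m V)%MS.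
Proof.
move=> aA; suff -> : row a V = row a (mask A *m V) by apply: row_sub.
by rewrite mul_mask; apply/rowP => j; rewrite !mxE aA mul1r.
Qed.

Lemma mask_subP A m (W : 'M_(m, d)) :
  (forall a, a \in A -> (row a V <= W)%MS) -> (mask A *m V <= W)%MS.
Proof.
move=> h; apply/row_subP => a; have [aA|naA] := boolP (a \in A).
  suff -> : row a (mask A *m V) = row a V by apply: h.
  by rewrite mul_mask; apply/rowP => j; rewrite !mxE aA mul1r.
suff -> : row a (mask A *m V) = 0 by apply: sub0mx.
by rewrite mul_mask; apply/rowP => j; rewrite !mxE (negbTE naA) mul0r.
Qed.

Lemma mask_subS A B : A \subset B -> (mask A *m V <= mask B *m V)%MS.
Proof. by move=> /subsetP AB; apply: mask_subP => a /AB; apply: row_mask_sub. Qed.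

(** A largest independent set between [B0] and [A] spans, since a vector of [A] outside its span
    could be added. *)
Lemma extend_basis A B0 : B0 \subset A -> rk B0 = #|B0| ->
  exists B, [/\ B0 \subset B, B \subset A, rk B = #|B| & (mask A *m V <= mask B *m V)%MS].
Proof.
move=> B0A /eqP rB0; pose P B := [&& B0 \subset B, B \subset A & rk B == #|B|].
have PB0 : P B0 by rewrite /P subxx B0A.
case: (@arg_maxnP _ B0 P (fun B => #|B|) PB0) => B /and3P[B0B BA rB] Bmax.
exists B; split=> //; first exact/eqP.
apply: mask_subP => a aA; apply: contraT => na.
have naB : a \notin B by apply: contra na; apply: row_mask_sub.
suff : P (a |: B) by move/Bmax => /=; rewrite cardsU1 naB add1n ltnn.
rewrite /P subUset sub1set aA BA (subset_trans B0B) ?subsetUr //=.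
rewrite eqn_leq rk_leq_card cardsU1 naB -(eqP rB) ltnNge.
apply: contra na => rle; have : (mask B *m V <= mask (a |: B) *m V)%MS.
  by apply: mask_subS; rewrite subsetUr.
move=> /mxrank_leqif_sup/geq_leqif/esym; rewrite rle => sub.
by apply: submx_trans sub; apply: row_mask_sub; rewrite setU11.
Qed.

(** The matroid greedy algorithm: a basis of the elements of weight at most [m] is extended to
    weight [m.+1], so the basis of each lower level stays inside [B]. *)
Lemma greedy_chain A (w : 'I_n -> nat) m :
  exists B, [/\ B \subset [set a in A | (w a <= m)%N], rk B = #|B|,
    (mask [set a in A | (w a <= m)%N] *m V <= mask B *m V)%MS &
    forall l, (l <= m)%N ->
      (rk [set a in A | (w a <= l)%N] <= #|[set b in B | (w b <= l)%N]|)%N].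
Proof.
have rk0 : rk set0 = #|(set0 : {set 'I_n})|.
  by apply/eqP; rewrite eqn_leq rk_leq_card cards0.
elim: m => [|m [B0 [B0A rB0 sB0 hB0]]].
  have [B [_ BA rB sB]] := extend_basis (sub0set [set a in A | (w a <= 0)%N]) rk0.
  exists B; split=> // l; rewrite leqn0 => /eqP->.
  have -> : [set b in B | (w b <= 0)%N] = B.
    apply/setP => b; rewrite inE; case bB: (b \in B) => //=.
    by have := subsetP BA b bB; rewrite inE => /andP[].
  by rewrite -rB; apply: mxrankS.
have B0A' : B0 \subset [set a in A | (w a <= m.+1)%N].
  apply: subset_trans B0A _; apply/subsetP => a; rewrite !inE => /andP[-> /=].
  exact: leqW.
have [B [B0B BA rB sB]] := extend_basis B0A' rB0.
exists B; split=> // l; rewrite leq_eqVlt => /orP[/eqP->|].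
  have -> : [set b in B | (w b <= m.+1)%N] = B.
    apply/setP => b; rewrite inE; case bB: (b \in B) => //=.
    by have := subsetP BA b bB; rewrite inE => /andP[].
  by rewrite -rB; apply: mxrankS.
rewrite ltnS => /hB0 /leq_trans; apply; apply: subset_leq_card.
by apply/subsetP => b; rewrite !inE => /andP[/(subsetP B0B)-> ->].
Qed.

(** Layer-cake formula: [w b] is the number of levels [l] with [l < w b]. *)
Lemma sum_layers (B : {set 'I_n}) (w : 'I_n -> nat) m : (forall b, w b <= m)%N ->
  (\sum_(b in B) w b = \sum_(l < m) #|[set b in B | (l < w b)%N]|)%N.
Proof.
move=> wm; under [RHS]eq_bigr => l _ do rewrite -sum1_card.
rewrite (exchange_big_dep (fun b => b \in B)) /=; last by move=> l b _; rewrite inE => /andP[].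
apply: eq_bigr => b bB; rewrite (eq_bigl (fun l : 'I_m => l < w b)%N); last first.
  by move=> l; rewrite inE bB.
by rewrite -[LHS]card_ord -sum1_card; apply: (big_ord_widen m (fun=> 1%N)).
Qed.

(* A basis built along increasing weights contains, for every [l], a basis of
   the elements of weight at most [l], and minimality of the ratio bounds the
   number of those from below. *)
Lemma light_basis A (w : 'I_n -> nat) m : (forall a, w a <= m)%N ->
  (forall A', A' \subset A -> rk A * #|A'| <= rk A' * #|A|)%N ->
  exists B, [/\ B \subset A, rk B = #|B|, (mask A *m V <= mask B *m V)%MS &
    (#|A| * \sum_(b in B) w b <= rk A * \sum_(a in A) w a)%N].
Proof.
move=> wm minA; have [B [BA rB sB hB]] := greedy_chain A w m.
have Am : [set a in A | (w a <= m)%N] = A by apply/setP => a; rewrite inE wm andbT.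
rewrite Am in BA sB; exists B; split=> //.
have rBA : rk A = #|B|.
  by rewrite -rB; apply/eqP; rewrite eqn_leq !mxrankS // mask_subS.
rewrite !(sum_layers _ wm) !big_distrr /=; apply: leq_sum => l _.
have split_card (D : {set 'I_n}) :
    #|D| = (#|[set b in D | (w b <= l)%N]| + #|[set b in D | (l < w b)%N]|)%N.
  rewrite -(cardsID [set b | (w b <= l)%N] D); congr (_ + _)%N.
    by congr #|pred_of_set _|; apply/setP => b; rewrite !inE.
  by congr #|pred_of_set _|; apply/setP => b; rewrite !inE ltnNge andbC.
have sA : [set a in A | (w a <= l)%N] \subset A.
  by apply/subsetP => a; rewrite inE => /andP[].
have hA := minA _ sA.
have hAB := leq_trans hA (leq_mul (hB l (ltnW (ltn_ord l))) (leqnn #|A|)).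
(* The totals [#|A| * #|B|] and [rk A * #|A|] agree, so the lower bound on the light elements of [B]
   becomes an upper bound on the heavy ones. *)
rewrite -(leq_add2l (rk A * #|[set a in A | (w a <= l)%N]|)) -mulnDr -split_card.
apply: leq_trans (leq_add hAB (leqnn _)) _.
by rewrite [X in (X + _ <= _)%N]mulnC -mulnDr -split_card rBA mulnC.
Qed.

Hypothesis V0 : forall a, row a V != 0.

Lemma exists_min_ratio : (0 < n)%N ->
  exists A, (0 < #|A|)%N /\ forall A', (rk A * #|A'| <= rk A' * #|A|)%N.
Proof.
move=> n0.
have P0 : (0 < #|[set: 'I_n]|)%N by rewrite cardsT card_ord.
case: (@arg_minP _ _ _ _ (fun A : {set 'I_n} => 0 < #|A|)%N
   (fun A => (rk A)%:R / #|A|%:R : R) P0) => A A0 minA.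
exists A; split=> // A'; have [->|A'0] := posnP #|A'|; first by rewrite muln0.
have := minA A' A'0; rewrite ler_pdivrMr ?ltr0n // mulrAC ler_pdivlMr ?ltr0n //.
by rewrite -!natrM ler_nat.
Qed.

Lemma dot_self_eq0 m (u : 'rV[R]_m) : u *m u^T = 0 -> u = 0.
Proof.
move=> /matrixP/(_ 0 0); rewrite !mxE => /eqP.
rewrite psumr_eq0 => [/allP uu|i _]; last by rewrite mxE -expr2 sqr_ge0.
apply/rowP => i; rewrite mxE; apply/eqP.
by have := uu i (mem_index_enum _); rewrite mxE mulf_eq0 orbb.
Qed.

Definition degree A a := #|[set u in A | (V *m V^T) a u != 0]|.

(* The vectors of [A] orthogonal to [a] have strictly smaller rank. *)
Lemma degree_lower_bound A a :
  (forall A', A' \subset A -> rk A * #|A'| <= rk A' * #|A|)%N ->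
  a \in A -> (#|A| <= rk A * degree A a)%N.
Proof.
move=> minA aA; pose A' := [set u in A | (V *m V^T) a u == 0].
have cA : #|A| = (#|A'| + degree A a)%N.
  rewrite -(cardsID [set u | (V *m V^T) a u == 0] A); congr (_ + _)%N.
    by congr #|pred_of_set _|; apply/setP => b; rewrite !inE.
  by congr #|pred_of_set _|; apply/setP => b; rewrite !inE andbC.
have A'A : A' \subset A by apply/subsetP => u; rewrite inE => /andP[].
(* If [a] were a combination of vectors orthogonal to it, its squared norm would vanish. *)
have rlt : (rk A' < rk A)%N.
  apply: rank_ltmx; rewrite /ltmx mask_subS //=; apply/negP => /(submx_trans (row_mask_sub aA)).
  case/submxP => z zE; case/eqP: (V0 a); apply: dot_self_eq0.
  rewrite {1}zE -2!mulmxA; apply/matrixP => i j; rewrite !mxE big1 // => u _.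
  rewrite mul_mask !mxE; have [|_] := boolP (u \in A'); last by rewrite mul0r mulr0.
  rewrite inE => /andP[_]; rewrite !mxE => /eqP au.
  suff -> : \sum_k V u k * (row a V)^T k j = 0 by rewrite mulr0 mulr0.
  by rewrite -[RHS]au; apply: eq_bigr => k _; rewrite !mxE mulrC.
(* Minimality gives [rk A * #|A'| <= (rk A - 1) * #|A|], and [#|A| - #|A'|] is the degree. *)
by have := minA A' A'A; nia.
Qed.

End SparseBasis.

Section GramForm.
Variables (R : realFieldType) (n d : nat).
Implicit Types (A B : {set 'I_n}) (V : 'M[R]_(n, d)).

(** For [X] the rows [B] of M[A] this is X^T M[B]^-1 X scaled by det M[B]. The adjugate replaces the
    inverse to keep the entries polynomial, and the identity off [B] completes M[B] to an [n] by [n]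
    matrix with the same determinant. *)
Definition gram_form B (X : 'M[R]_n) : 'M[R]_n :=
  X^T *m \adj (X *m mask R B + (1%:M - mask R B)) *m X.

(* If [mask A *m V = W *m mask B *m V] then [X = Y *m mask B *m W^T] for the
   matrix [Y] whose adjugate occurs in [gram_form B X]. *)
Lemma gram_formP A B V : B \subset A -> rk V B = #|B| ->
  (mask R A *m V <= mask R B *m V)%MS ->
  exists2 c : R, c != 0 &
    gram_form B (mask R B *m (V *m V^T) *m mask R A) =
      c *: (mask R A *m (V *m V^T) *m mask R A).
Proof.
move=> BA rB /submxP[W WE].
have trm C : (mask R C)^T = mask R C by rewrite tr_diag_mx.
have BB : mask R B *m mask R B = mask R B by rewrite mask_subset.
have AB : mask R A *m mask R B = mask R B by rewrite maskI setIC -maskI mask_subset.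
set X := mask R B *m (V *m V^T) *m mask R A.
rewrite /gram_form; set Y := X *m mask R B + _.
have YE : Y = mask R B *m (V *m V^T) *m mask R B + (1%:M - mask R B).
  by rewrite /Y /X -mulmxA AB.
have VA : V^T *m mask R A = V^T *m mask R B *m W^T.
  by rewrite -[LHS]trmxK trmx_mul trmxK trm WE !trmx_mul trm.
have XE : X = Y *m (mask R B *m W^T).
  rewrite YE mulmxDl (mulmxA (1%:M - _)) mulmxBl mul1mx BB subrr mul0mx addr0.
  by rewrite (mulmxA _ (mask R B) W^T) -(mulmxA _ (mask R B) (mask R B)) BB /X -!mulmxA VA !mulmxA.
exists (\det Y).
  (* A null vector of [Y] is supported on [B] and gives a combination of the vectors of [B] with
     zero norm; these vectors are independent. *)
  suff : Y \in unitmx by rewrite unitmxE unitfE.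
  rewrite -row_free_unit; apply: inj_row_free => u.
  rewrite YE mulmxDr => uY.
  have uB0 : u *m (1%:M - mask R B) = 0.
    have := congr1 (fun z => z *m (1%:M - mask R B)) uY.
    rewrite mul0mx mulmxDl -!mulmxA (mulmxBr (mask R B)) mulmx1 BB subrr !mulmx0 add0r.
    by rewrite mulmxBr mulmx1 (mulmxBl 1%:M) mul1mx BB subrr subr0.
  have uB : u *m mask R B = u by apply/esym/eqP; rewrite -subr_eq0 -{1}(mulmx1 u) -mulmxBr uB0.
  have : u *m mask R B *m V = 0.
    apply: dot_self_eq0; rewrite !trmx_mul trm !mulmxA.
    move: uY; rewrite uB0 addr0 => /(congr1 (fun z => z *m u^T)).
    by rewrite mul0mx !mulmxA.
  have := mxrank_mul_ker (mask R B) V; rewrite -/(rk V B) rB => rker uV.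
  have ker0 : (mask R B :&: kermx V)%MS = 0.
    by apply/eqP; rewrite -mxrank_eq0; have := rank_mask R B; lia.
  have : (u <= mask R B :&: kermx V)%MS.
    by rewrite sub_capmx -{1}uB submxMl; apply/sub_kermxP; rewrite -uB.
  by rewrite ker0 submx0 => /eqP.
rewrite -mulmxA {2}XE (mulmxA (\adj Y)) mul_adj_mx mul_scalar_mx -scalemxAr; congr (_ *: _).
rewrite /X !trmx_mul !trm trmxK !mulmxA -(mulmxA _ (mask R B) (mask R B)) BB.
by rewrite -(mulmxA (mask R A) V V^T) -!mulmxA VA !mulmxA.
Qed.

End GramForm.

(** * Supports of Gram matrices *)

Section GramPatterns.
Variables (R : realFieldType) (I : finType).

Lemma poly_funD e f g : poly_fun e f -> poly_fun e g ->
  poly_fun e (fun x : I -> R => f x + g x).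
Proof.
move=> Pf Pg; pose h (b : bool) := if b then f else g.
apply: (@eq_poly_fun _ _ _ (fun x => \sum_b h b x)) => [x|]; first by rewrite big_bool.
by apply: poly_fun_sum => -[].
Qed.

Lemma poly_fun_mulmx m n q d1 d2 (A : (I -> R) -> 'M[R]_(m, n)) (B : (I -> R) -> 'M[R]_(n, q)) :
  (forall i j, poly_fun d1 (fun x => A x i j)) ->
  (forall i j, poly_fun d2 (fun x => B x i j)) ->
  forall i j, poly_fun (d1 + d2) (fun x => (A x *m B x) i j).
Proof.
move=> PA PB i j.
apply: (@eq_poly_fun _ _ _ (fun x => \sum_k A x i k * B x k j)) => [x|]; first by rewrite mxE.
by apply: poly_fun_sum => k _; apply: poly_funM.
Qed.

Lemma poly_fun_det m (A : (I -> R) -> 'M[R]_m) :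
  (forall i j, poly_fun 1 (fun x => A x i j)) -> poly_fun m (fun x => \det (A x)).
Proof.
move=> PA; apply: poly_fun_sum => s _; apply: (@poly_fun_leq _ _ (0 + m)) => //.
apply: poly_funM; first exact: poly_fun_cst.
have := poly_fun_prod [set: 'I_m] (fun i => PA i ((s : 'S_m) i)).
rewrite mul1n cardsT card_ord; apply: eq_poly_fun => x.
by apply: eq_bigl => i; rewrite inE.
Qed.

Lemma poly_fun_adj m (A : (I -> R) -> 'M[R]_m) :
  (forall i j, poly_fun 1 (fun x => A x i j)) ->
  forall i j, poly_fun m.-1 (fun x => (\adj (A x)) i j).
Proof.
move=> PA i j.
apply: (@eq_poly_fun _ _ _ (fun x => (-1) ^+ (j + i) * \det (row' j (col' i (A x))))) => [x|].
  by rewrite mxE.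
apply: (@poly_fun_leq _ _ (0 + m.-1)) => //; apply: poly_funM; first exact: poly_fun_cst.
apply: poly_fun_det => a b; apply: eq_poly_fun (PA (lift j a) (lift i b)) => x.
by rewrite !mxE.
Qed.

End GramPatterns.

Section Certificates.
Variable R : realFieldType.
Variable n : nat.
Implicit Types (T H S : {set 'I_n * 'I_n}).

Definition entries T (x : {y | y \in T} -> R) : 'M[R]_n :=
  \matrix_(i, j) if insub (i, j) is Some y then x y else 0.

(** Recovers the basis from the position set alone: Gram matrices of nonzero vectors have nonzero
    diagonal, so each basis element [b] occurs through [(b, b)]. *)
Definition heads T : {set 'I_n} := [set b | [exists a, (b, a) \in T]].

(* The nonzero entries, above the diagonal, of the Gram matrix whose rows
   indexed by [heads T] have support [T] and values [x]. *)
Definition gram_pattern T (x : {y | y \in T} -> R) : {set 'I_n * 'I_n} :=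
  [set y : 'I_n * 'I_n | (y.1 < y.2)%N && (gram_form (heads T) (entries x) y.1 y.2 != 0)].

Lemma card_gram_patterns T (P : {set {set 'I_n * 'I_n}}) :
  (forall H, H \in P -> exists x : {y | y \in T} -> R, H = gram_pattern x) ->
  (#|P| <= (n.+1 * (n * n)).+1 ^ #|T|)%N.
Proof.
move=> PP; pose f (y : 'I_n * 'I_n) (x : {y | y \in T} -> R) : R :=
  if (y.1 < y.2)%N then gram_form (heads T) (entries x) y.1 y.2 else 0.
have {PP}PP H : H \in P -> exists x, H = [set y | f y x != 0].
  move=> /PP[x ->]; exists x; apply/setP => y; rewrite !inE /f.
  by case: ifP; rewrite ?eqxx.
have cT : #|{: {y | y \in T}}| = #|T| by rewrite card_sig; apply: eq_card => y; rewrite inE.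
have := card_zero_patterns (d := n.+1) _ PP.
rewrite cT card_prod card_ord; apply=> -[i j]; rewrite /f /=.
case: (i < j)%N; last exact: poly_fun_cst.
have Pent a b : poly_fun 1 (fun x : {y | y \in T} -> R => entries x a b).
  case abT: ((a, b) \in T); last first.
    refine (@eq_poly_fun _ _ _ (fun=> 0) _ _ (poly_fun_cst _ _ _)) => x.
    by rewrite mxE insubN ?abT.
  refine (@eq_poly_fun _ _ _ (fun x => x (exist _ (a, b) abT)) _ _ (poly_fun_var _ _)) => x.
  by rewrite mxE insubT.
have PT a b : poly_fun 1 (fun x : {y | y \in T} -> R => (entries x)^T a b).
  by refine (@eq_poly_fun _ _ _ _ _ _ (Pent b a)) => x; rewrite [RHS]mxE.
have n0 : (0 < n)%N by apply: leq_ltn_trans (ltn_ord i).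
(* Degree 1 from each outer factor and [n.-1] from the cofactors. *)
apply: (@poly_fun_leq _ _ (1 + n.-1 + 1)); first by lia.
apply: (poly_fun_mulmx _ Pent); apply: (poly_fun_mulmx PT); apply: poly_fun_adj => a b.
apply: (@eq_poly_fun _ _ _ (fun x => entries x a b * (b \in heads T)%:R +
   (1%:M - mask R (heads T)) a b)) => [x|].
  by rewrite [RHS]mxE mul_mx_mask [X in _ = X + _]mxE.
apply: poly_funD; last exact: poly_fun_cst.
by rewrite -[1%N]addn0; apply: poly_funM (Pent a b) (poly_fun_cst _ _ _).
Qed.

(** Turns degrees into edges: the diagonal contributes [#|A|], and symmetry pairs the remaining
    nonzero entries. *)
Lemma card_support (A : {set 'I_n}) (M : 'M[R]_n) : M^T = M ->
  (forall a, a \in A -> M a a != 0) ->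
  (\sum_(a in A) #|[set u in A | M a u != 0%R]| =
   #|A| + 2 * #|[set y : 'I_n * 'I_n |
      [&& (y.1 < y.2)%N, y.1 \in A, y.2 \in A & M y.1 y.2 != 0%R]]|)%N.
Proof.
move=> MT M0; set H := [set y | _].
have Msym a b : M a b = M b a by rewrite -{1}MT mxE.
transitivity #|[set y : 'I_n * 'I_n | [&& y.1 \in A, y.2 \in A & M y.1 y.2 != 0]]|.
  rewrite -[RHS]sum1_card (partition_big (fun y => y.1) (fun a => a \in A)) /=; last first.
    by move=> y; rewrite inE => /andP[].
  apply: eq_bigr => a aA; rewrite -sum1_card.
  rewrite (reindex_onto (fun u => (a, u)) (fun y => y.2)) /=; last first.
    by move=> [a' u] /= /andP[_ /eqP->].
  by apply: eq_bigl => u; rewrite !inE /= aA !eqxx !andbT.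
set D := [set y | _].
have cdiag : #|[set y in D | y.1 == y.2]| = #|A|.
  have inj : injective (fun a : 'I_n => (a, a)) by move=> a b [].
  rewrite -(card_imset A inj); congr #|pred_of_set _|.
  apply/setP => -[a b]; rewrite !inE /=; apply/idP/imsetP => [|[c cA [-> ->]]].
    by case/andP=> /and3P[aA _ _] /eqP<-; exists a.
  by rewrite cA M0 ?eqxx.
have clt : #|[set y : 'I_n * 'I_n in D | (y.1 < y.2)%N]| = #|H|.
  by congr #|pred_of_set _|; apply/setP => y; rewrite !inE andbC.
have cgt : #|[set y : 'I_n * 'I_n in D | (y.2 < y.1)%N]| = #|H|.
  pose sw (y : 'I_n * 'I_n) := (y.2, y.1).
  have inj : injective sw by move=> [a b] [a' b'] [-> ->].
  rewrite -(card_imset H inj); congr #|pred_of_set _|.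
  apply/setP => -[a b]; rewrite !inE /=; apply/idP/imsetP => [|[[c e] + [-> ->]]].
    by case/andP=> /and3P[aA bA ab] ba; exists (b, a); rewrite // inE /= ba bA aA Msym.
  by rewrite inE /= => /and4P[-> -> ->]; rewrite Msym => ->.
rewrite -(cardsID [set y : 'I_n * 'I_n | y.1 == y.2] D) -cdiag; congr (_ + _)%N.
  by congr #|pred_of_set _|; apply/setP => y; rewrite !inE.
rewrite -(cardsID [set y : 'I_n * 'I_n | (y.1 < y.2)%N]) mul2n -addnn -{1}clt -cgt; congr (_ + _)%N.
  congr #|pred_of_set _|; apply/setP => -[a b]; rewrite !inE /= -val_eqE /=.
  by case: ltngtP; rewrite ?andbF ?andbT.
congr #|pred_of_set _|; apply/setP => -[a b]; rewrite !inE /= -val_eqE /=.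
by case: ltngtP; rewrite ?andbF ?andbT.
Qed.

(* Here [a] and [k] are the size and the rank of a vertex set of minimal ratio,
   [H] is the support of its Gram matrix and [T] that of the rows in a light
   basis. *)
Lemma gram_certificate d (V : 'M[R]_(n, d)) : (0 < n)%N -> (forall i, row i V != 0) ->
  exists (T H : {set 'I_n * 'I_n}) (x : {y | y \in T} -> R) (a k : nat),
    [/\ H = gram_pattern x,
        forall y, y \in H -> (V *m V^T) y.1 y.2 != 0,
        (0 < a)%N /\ (0 < #|T|)%N, (k * n <= d * a)%N &
        (a * #|T| <= k * (a + 2 * #|H|))%N /\ (a * a <= k * (a + 2 * #|H|))%N].
Proof.
move=> n0 V0; have [A [A0 minA]] := exists_min_ratio V n0.
have minA' (A' : {set 'I_n}) (_ : A' \subset A) := minA A'.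
pose w := degree V A.
have wn a : (w a <= n)%N by rewrite -[leqRHS](card_ord n) max_card.
have [B [BA rB sB lB]] := light_basis wn minA'.
have [c c0 cE] := gram_formP BA rB sB.
set M := V *m V^T in cE *.
have MT : M^T = M by rewrite trmx_mul trmxK.
have M0 a : M a a != 0.
  apply: contraNneq (V0 a) => Ma0; apply/eqP/dot_self_eq0/matrixP => i j.
  by rewrite [RHS]mxE -[RHS]Ma0 !mxE; apply: eq_bigr => l _; rewrite !mxE.
pose T := [set y : 'I_n * 'I_n | [&& y.1 \in B, y.2 \in A & M y.1 y.2 != 0]].
pose x (y : {y | y \in T}) := M (val y).1 (val y).2.
have hT : heads T = B.
  apply/setP => b; rewrite inE; apply/existsP/idP => [[a]|bB]; first by rewrite inE => /andP[].
  by exists b; rewrite inE /= bB (subsetP BA) ?M0.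
have xE : entries x = mask R B *m M *m mask R A.
  rewrite mul_mask; apply/matrixP => i j; rewrite mul_mx_mask [RHS]mxE [X in X * _]mxE mxE.
  case: insubP => [y _ yE|]; last first.
    rewrite inE /= !negb_and negbK.
    case: (i \in B); last by rewrite !mul0r.
    by case: (j \in A); rewrite ?mulr0 //= => /eqP->; rewrite mulr0 mul0r.
  rewrite /x yE; move: (valP y); rewrite yE inE /= => /and3P[-> -> _].
  by rewrite mul1r mulr1.
have HE : gram_pattern x = [set y : 'I_n * 'I_n |
      [&& (y.1 < y.2)%N, y.1 \in A, y.2 \in A & M y.1 y.2 != 0]].
  apply/setP => -[i j]; rewrite !inE /= hT xE cE mxE mulf_eq0 (negbTE c0) /=.
  rewrite mul_mask mul_mx_mask [X in X != 0]mxE [X in X * _ != 0]mxE.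
  case: (i \in A); rewrite ?mul0r ?mul1r ?eqxx ?andbF //.
  by case: (j \in A); rewrite ?mulr0 ?mulr1 ?eqxx ?andbF.
have sE : (\sum_(a in A) w a = #|A| + 2 * #|gram_pattern x|)%N.
  by rewrite HE -card_support.
have TE : #|T| = (\sum_(b in B) w b)%N.
  rewrite -sum1_card (partition_big (fun y => y.1) (fun b => b \in B)) /=; last first.
    by move=> y; rewrite inE => /andP[].
  apply: eq_bigr => b bB; rewrite /w /degree -sum1_card.
  rewrite (reindex_onto (fun u => (b, u)) (fun y => y.2)) /=; last first.
    by move=> [a' u] /= /andP[_ /eqP->].
  by apply: eq_bigl => u; rewrite !inE /= bB !eqxx !andbT.
exists T, (gram_pattern x), x, #|A|, (rk V A); split=> //.
- by move=> y; rewrite HE inE => /and4P[].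
- split=> //; have /card_gt0P[a aA] := A0.
  have rA : (0 < rk V A)%N.
    rewrite lt0n mxrank_eq0; apply: contraNneq (V0 a) => A00.
    by have := row_mask_sub V aA; rewrite A00 => /submx0null->.
  have : (rk V A <= #|B|)%N by rewrite -rB mxrankS.
  move=> /(leq_trans rA)/card_gt0P[b bB]; apply/card_gt0P; exists (b, b).
  by rewrite inE /= bB (subsetP BA) ?M0.
(* The minimal ratio is compared with that of the whole vertex set, whose rank is at most [d]. *)
- have := minA [set: 'I_n]; rewrite cardsT card_ord => /leq_trans; apply.
  by rewrite leq_mul2r rank_leq_col orbT.
- rewrite -sE TE; split=> //.
  rewrite big_distrr /= -[X in (_ * X)%N]sum1_card big_distrr /=; apply: leq_sum => a aA.
  by rewrite muln1; apply: degree_lower_bound.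
Qed.

End Certificates.

(** * Numerical estimates *)

Section RealEstimates.
Local Open Scope R_scope.

Lemma exp_ge_cube z : 0 <= z -> z ^ 3 / 27 <= exp z.
Proof.
move=> z0; have -> : exp z = exp (z / 3) ^ 3.
  by rewrite -Rpower_pow ?/Rpower ?ln_exp; [congr exp; rewrite /=; field | exact: exp_pos].
have -> : z ^ 3 / 27 = (z / 3) ^ 3 by field.
by apply: pow_incr; have := exp_ineq1_le (z / 3); lra.
Qed.

Variables (n : nat) (p : R).
(** The threshold exceeds 2160000, the value from which the cubic lower bound on [exp] yields
    [exp_y_bound]. *)
Hypothesis n_large : 3000000 <= ln (INR n).
Hypothesis p_range : / INR n <= p <= 1 - Rpower (INR n) (- (99 / 100)).
Let y := ln (INR n).
Let L := - ln p.

Lemma n_pos : 0 < INR n.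
Proof.
case: (Rle_lt_dec (INR n) 0) => // h; have n0 : INR n = 0 by have := pos_INR n; lra.
(* [ln] is 0 by convention at arguments that are not positive. *)
have : ln (INR n) = 0 by rewrite n0 /ln; case: Rlt_dec => // h0; case: (Rlt_irrefl 0).
by lra.
Qed.

Lemma exp_y : exp y = INR n.
Proof. exact: exp_ln n_pos. Qed.

Lemma p_pos : 0 < p.
Proof. by have := Rinv_0_lt_compat _ n_pos; lra. Qed.

Lemma p_lt1 : p < 1.
Proof. by have := exp_pos (- (99 / 100) * ln (INR n)); rewrite -/(Rpower _ _); lra. Qed.

Lemma L_le_y : L <= y.
Proof.
have h : ln (/ INR n) <= ln p.
  case: (Req_dec (/ INR n) p) => [->|ne]; first by lra.
  by apply/Rlt_le/ln_increasing; have := Rinv_0_lt_compat _ n_pos; lra.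
by move: h; rewrite ln_Rinv ?/L ?/y; [lra|exact: n_pos].
Qed.

Lemma L_ge : exp (- (99 / 100) * y) <= L.
Proof.
have := exp_ineq1_le (ln p); rewrite exp_ln ?/L; last exact: p_pos.
by case: p_range; rewrite /Rpower -/y; lra.
Qed.

Lemma L_pos : 0 < L.
Proof. by have := L_ge; have := exp_pos (- (99 / 100) * y); lra. Qed.

Lemma exp_y_bound : y ^ 2 <= 100 * exp (y / 200).
Proof.
have y0 : 3000000 <= y by [].
have := @exp_ge_cube (y / 200) ltac:(lra).
suff : y ^ 2 <= 100 * ((y / 200) ^ 3 / 27) by lra.
have -> : 100 * ((y / 200) ^ 3 / 27) = y ^ 2 * (y / 2160000) by field.
rewrite -{1}(Rmult_1_r (y ^ 2)); apply: Rmult_le_compat_l; first by apply: pow2_ge_0.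
by lra.
Qed.

(** Take [k] just above K = 200 n L / y. Then L n / k <= y / 200, so p^(n/k) >= n^(-1/200), while n
    L >= n^(1/100) makes K at least 2 y n^(1/200). Hence each vertex fails with probability at most
    n^-2. The constant 400 absorbs the rounding, as K >= 1. *)
Lemma colour_number : exists k : nat,
  [/\ 0 < INR k, INR k <= 400 * (INR n * L) / y &
   INR n * exp (- (INR k * exp (- (L * (INR n / INR k))))) <= / INR n].
Proof.
have y0 : 3000000 <= y by [].
pose K := 200 * (INR n * L) / y.
have nL : exp (y / 100) <= INR n * L.
  have -> : exp (y / 100) = INR n * exp (- (99 / 100) * y).
    by rewrite -exp_y -exp_plus; congr exp; field.
  by apply: Rmult_le_compat_l L_ge; apply: pos_INR.
have eK : 200 * (exp (y / 200) * exp (y / 200)) / y <= K.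
  rewrite -exp_plus; have -> : y / 200 + y / 200 = y / 100 by field.
  by apply: Rmult_le_compat_r; [apply/Rlt_le/Rinv_0_lt_compat|]; lra.
have E0 := exp_y_bound.
have E1 : y <= exp (y / 200).
  have h : 100 * y <= y ^ 2 by rewrite /= Rmult_1_r; apply: Rmult_le_compat_r; lra.
  by lra.
have eK2 : 2 * y * exp (y / 200) <= K.
  apply: Rle_trans eK.
  apply: (Rmult_le_reg_r y); first lra.
  have -> : 200 * (exp (y / 200) * exp (y / 200)) / y * y =
    2 * exp (y / 200) * (100 * exp (y / 200)) by field; lra.
  have -> : 2 * y * exp (y / 200) * y = 2 * exp (y / 200) * y ^ 2 by ring.
  by apply: Rmult_le_compat_l; lra.
have K1 : 1 <= K.
  apply: Rle_trans eK2; have : 1 * 1 <= 2 * y * exp (y / 200) by apply: Rmult_le_compat; lra.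
  by lra.
have [upK upK1] := archimed K.
have up0 : Z.le Z0 (up K) by apply: le_IZR; lra.
exists (Z.to_nat (up K)); rewrite INR_IZR_INZ Z2Nat.id //.
set k := IZR (up K) in upK upK1 *.
have k0 : 0 < k by lra.
split=> //.
  have -> : 400 * (INR n * L) / y = 2 * K by rewrite /K; field; lra.
  by lra.
have e1 : exp (- (y / 200)) <= exp (- (L * (INR n / k))).
  have : L * (INR n / k) <= y / 200; last first.
    by case=> [lt|->]; [apply/Rlt_le/exp_increasing|]; lra.
  apply: (Rmult_le_reg_r (k * (200 / y))).
    by apply: Rmult_lt_0_compat => //; apply: Rdiv_lt_0_compat; lra.
  have -> : L * (INR n / k) * (k * (200 / y)) = K by rewrite /K; field; lra.
  have -> : y / 200 * (k * (200 / y)) = k by field; lra.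
  by lra.
have e2 : 2 * y <= k * exp (- (L * (INR n / k))).
  apply: (Rle_trans _ (k * exp (- (y / 200)))); last by apply: Rmult_le_compat_l; lra.
  apply: (Rle_trans _ (2 * y * exp (y / 200) * exp (- (y / 200)))).
    rewrite Rmult_assoc -exp_plus Rplus_opp_r exp_0; lra.
  by apply: Rmult_le_compat_r; [apply/Rlt_le/exp_pos|lra].
have -> : / INR n = INR n * exp (- (2 * y)).
  rewrite -exp_y -exp_plus -exp_Ropp; congr exp; ring.
apply: Rmult_le_compat_l; first exact: pos_INR.
by case: e2 => [lt|->]; [apply/Rlt_le/exp_increasing|]; lra.
Qed.

(* With [rho = L / (64 y)], the ratio [k / a] is below [rho], so that
   [t <= rho * (a + 2 h)] and [a <= rho * (a + 2 h)]. *)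
Lemma certificate_weight (d a k t h : nat) :
  INR d < INR n * L / (64 * y) -> (0 < a)%N -> (k * n <= d * a)%N ->
  (a * t <= k * (a + 2 * h))%N -> (a * a <= k * (a + 2 * h))%N ->
  p ^ h <= (/ INR n) ^ (16 * t).
Proof.
move=> dn /ssrnat.ltP/lt_INR /= a0 /ssrnat.leP/le_INR kn.
move=> /ssrnat.leP/le_INR ta /ssrnat.leP/le_INR aa.
have INR2 : INR 2 = 2 by [].
move: kn ta aa; rewrite -multE -plusE !mult_INR !(plus_INR a) !mult_INR INR2 => kn ta aa.
have y0 : 3000000 <= y by [].
have n0 := n_pos; have L0 := L_pos; have Ly := L_le_y.
set A := INR a in a0 kn ta aa; set kk := INR k in kn ta aa.
set s := A + 2 * INR h in ta aa.
pose rho := L / (64 * y).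
have h0 : 0 <= INR h by apply: pos_INR.
have s0 : 0 < s by rewrite /s; lra.
have krho : kk <= rho * A.
  apply: (Rmult_le_reg_r (INR n)) => //; apply: (Rle_trans _ (INR d * A)) => //.
  have -> : rho * A * INR n = INR n * L / (64 * y) * A by rewrite /rho; field; lra.
  by apply: Rmult_le_compat_r; lra.
have ks : kk * s <= A * (rho * s).
  have -> : A * (rho * s) = rho * A * s by ring.
  by apply: Rmult_le_compat_r; lra.
have trho : INR t <= rho * s by apply: (Rmult_le_reg_l A); lra.
have arho : A <= rho * s by apply: (Rmult_le_reg_l A); lra.
have rho1 : rho <= 1 / 2.
  apply: (Rmult_le_reg_r (64 * y)); first lra.
  by rewrite /rho; have -> : L / (64 * y) * (64 * y) = L by [field; lra]; lra.
have as2 : A <= s / 2.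
  by have := Rmult_le_compat_r s _ _ (Rlt_le _ _ s0) rho1; lra.
have rho0 : 0 <= rho.
  by apply/Rlt_le/Rdiv_lt_0_compat; lra.
(* Most of [s] comes from the edges. The factor 4 here and the 16 in the exponent account for the 64
   in [rho]. *)
have hs : s <= 4 * INR h by move: as2; rewrite /s; lra.
have tL : 16 * INR t * y <= L * INR h.
  have : INR t <= rho * (4 * INR h) by apply: (Rle_trans _ _ _ trho); apply: Rmult_le_compat_l.
  move=> /(Rmult_le_compat_r (16 * y) _ _ ltac:(lra)).
  have -> : rho * (4 * INR h) * (16 * y) = L * INR h by rewrite /rho; field; lra.
  by lra.
have -> : p ^ h = exp (- (L * INR h)).
  rewrite -Rpower_pow ?/Rpower; last exact: p_pos.
  by congr exp; rewrite /L; ring.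
have -> : (/ INR n) ^ (16 * t) = exp (- (16 * INR t * y)).
  rewrite -Rpower_pow ?/Rpower; last by apply: Rinv_0_lt_compat.
  rewrite ln_Rinv // -multE mult_INR (_ : INR 16 = 16) //; last by rewrite /=; ring.
  by congr exp; rewrite /y; ring.
by case: tL => [lt|->]; [apply/Rlt_le/exp_increasing|]; lra.
Qed.

End RealEstimates.

(** * The random graph *)

Section RandomGraph.
Variable n : nat.
Implicit Types S : {set 'I_n * 'I_n}.

Definition indicator (P : Prop) : R := `[< P >]%:R.

Lemma gnp_prob_expect (p : R) (P : {set 'I_n * 'I_n} -> Prop) :
  gnp_prob p P = expect p (pairs n) (fun S => indicator (P S)).
Proof.
apply: eq_bigr => S _; rewrite /indicator.
case: ClassicalEpsilon.excluded_middle_informative => PS.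
  by rewrite asboolT // mulr1 !RpowE.
by rewrite asboolF // mulr0.
Qed.

Lemma clique_cover_orth_rep k S : clique_colorable k n S -> has_orth_rep S k.
Proof.
move=> /existsP[c /clique_coloringP cP].
exists (fun i j => if c i == j then 1 else 0); split => [i|i j ij nadj].
  by exists (c i); rewrite eqxx; apply/eqP; rewrite oner_eq0.
apply: big1 => l _; case: eqP => [il|_]; last by rewrite RmultE mul0r.
case: eqP => [jl|_]; last by rewrite RmultE mulr0.
have cij : c i = c j by rewrite il jl.
move: nadj; rewrite /adj negb_or => /andP[nij nji].
case: (ltngtP i j) => lt; last by move: ij; rewrite -val_eqE /= lt eqxx.
  by move: nij; rewrite cP // lt ltn_ord.
by move: nji; rewrite cP // lt ltn_ord.
Qed.

Lemma exists_min_orth_dim k S : has_orth_rep S k ->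
  exists2 d, min_orth_dim S d & (d <= k)%N.
Proof.
move=> hk; have ex : exists d, `[< has_orth_rep S d >] by exists k; apply/asboolP.
have := ex_minnP ex; case=> d /asboolP hd dmin.
exists d; last by apply: dmin; apply/asboolP.
by split=> // d' lt /asboolP/dmin; rewrite leqNgt lt.
Qed.

Lemma prod_le_exp (I : finType) (y : I -> R) : (forall i, y i <= 1) ->
  \prod_i (1 - y i) <= exp (- \sum_i y i)%R.
Proof.
(* Nonnegativity is carried along so that the factorwise bounds can be multiplied. *)
move=> y1; suff /andP[] : 0 <= \prod_i (1 - y i) <= exp (- \sum_i y i)%R by [].
apply: (big_ind2 (fun a b => 0 <= a <= exp (- b)%R)) => [|a b a' b'|i _].
- by rewrite oppr0 expR0 ler01 lexx.
- move=> /andP[a0 ab] /andP[a'0 ab']; rewrite mulr_ge0 //= opprD -expRD.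
  by apply: ler_pM.
- rewrite subr_ge0 y1 /=; apply/RleP; exact: exp_ineq1_le.
Qed.

(* The tangent line of the convex function [m |-> p ^ m] at the average
   [n / k] of the [F j]. *)
Lemma prod_fibres_bound (p : R) k (F : 'I_k -> nat) :
  (0 < p)%R -> (p <= 1)%R -> (\sum_j F j <= n)%N -> (0 < k)%N ->
  \prod_j (1 - p ^+ F j) <=
    exp (- (k%:R * exp (- (- ln p * (n%:R / k%:R)))%R))%R.
Proof.
move=> p0 p1 Fn k0; set L := - ln p; set y := n%:R / k%:R.
have L0 : 0 <= L.
  rewrite /L oppr_ge0; have <- : ln 1 = 0 by rewrite ln_1.
  case: (eqVneq p 1) => [->|ne]; first exact: lexx.
  by apply/RleP/Rlt_le/ln_increasing; apply/RltP => //; rewrite lt_neqAle ne.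
have pm m : p ^+ m = exp (- (L * m%:R))%R.
  rewrite -RpowE -Rpower_pow; last exact/RltP.
  by rewrite /Rpower INRE /L mulNr opprK mulrC.
apply: le_trans (prod_le_exp _) _ => [j|]; first by rewrite exprn_ile1 // ltW.
have exp_le a b : a <= b -> exp a <= exp b.
  rewrite le_eqVlt => /orP[/eqP->|/RltP lt]; first exact: lexx.
  by apply/ltW/RltP/exp_increasing.
apply: exp_le; rewrite lerN2.
have tangent j : exp (- (L * y))%R * (1 - L * ((F j)%:R - y)) <= p ^+ F j.
  have -> : p ^+ F j = exp (- (L * y))%R * exp (- (L * ((F j)%:R - y)))%R.
    by rewrite expRD pm RplusE; congr exp; rewrite mulrBr opprB addKr.
  rewrite ler_pM2l; last exact/RltP/exp_pos.
  by apply/RleP; exact: exp_ineq1_le.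
apply: le_trans (ler_sum _ (fun j _ => tangent j)).
rewrite -mulr_sumr mulrC ler_pM2l; last exact/RltP/exp_pos.
rewrite sumrB -mulr_sumr sumrB !sumr_const card_ord -natr_sum.
rewrite -[y *+ k]mulr_natr /y divfK ?pnatr_eq0 -?lt0n //.
(* The linear terms add up to [- L * (\sum_j F j - n)], which is nonnegative. *)
by rewrite lerDl oppr_ge0 mulr_ge0_le0 // subr_le0 ler_nat.
Qed.

End RandomGraph.

(** * Failure probabilities of the two bounds *)

Section UnionBound.
Local Open Scope R_scope.

(** With q = 1/n, the power is at most exp(n^2 q^3) = exp(q), and exp(q) <= 1 + 2q for q <= 1/2. *)
Lemma pow_inv_cube_bound (n : nat) : 2 <= INR n ->
  (1 + (/ INR n) ^ 3) ^ (n * n) - 1 <= 2 * / INR n.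
Proof.
move=> n2; set q := / INR n.
have q0 : 0 < q by apply: Rinv_0_lt_compat; lra.
have q2 : q <= 1 / 2.
  by rewrite /q; have := Rinv_le_contravar 2 (INR n) ltac:(lra) n2; lra.
have e1 : (1 + q ^ 3) ^ (n * n) <= exp q.
  have -> : exp q = exp (q ^ 3) ^ (n * n).
    rewrite -Rpower_pow; last exact: exp_pos.
    by rewrite /Rpower ln_exp -multE mult_INR /q; congr exp; field; lra.
  apply: pow_incr; split; last exact: exp_ineq1_le.
  by have := pow_lt q 3 q0; lra.
have e2 : exp q * (1 - q) <= 1.
  apply: (Rle_trans _ (exp q * exp (- q))); last by rewrite -exp_plus Rplus_opp_r exp_0; lra.
  by apply: Rmult_le_compat_l; [apply/Rlt_le/exp_pos|have := exp_ineq1_le (- q); lra].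
suff : exp q <= 1 + 2 * q by lra.
have q3 : 0 <= q * (1 - 2 * q) by apply: Rmult_le_pos; lra.
apply: (Rmult_le_reg_r (1 - q)); first lra.
have -> : (1 + 2 * q) * (1 - q) = 1 + q * (1 - 2 * q) by ring.
by lra.
Qed.

Variables (n : nat) (p : R).
Hypothesis n_large : 3000000 <= ln (INR n).
Hypothesis p_range : / INR n <= p <= 1 - Rpower (INR n) (- (99 / 100)).

Lemma n_ge2 : 2 <= INR n.
Proof.
have := exp_ineq1_le (ln (INR n)); rewrite exp_ln; last exact: n_pos n_large.
by lra.
Qed.

Lemma p01 : (0 <= p <= 1)%R.
Proof.
have p0 := p_pos n_large p_range; have p1 := p_lt1 p_range.
by apply/andP; split; apply/RleP; apply: Rlt_le.
Qed.

(** This family does not depend on any particular representation, so the union bound can run over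
    it. *)
Definition light_patterns (T : {set 'I_n * 'I_n}) : {set {set 'I_n * 'I_n}} :=
  [set H | `[< (exists x : {y | y \in T} -> R, H = gram_pattern x) /\
               p ^ #|H| <= (/ INR n) ^ (16 * #|T|) >]].

Lemma light_patternsP d (S : {set 'I_n * 'I_n}) : S \subset pairs n ->
  has_orth_rep S d -> INR d < INR n * - ln p / (64 * ln (INR n)) ->
  exists2 T, T != set0 & [exists H in light_patterns T, H \subset S].
Proof.
move=> SE [v [v0 vS]] dn.
pose V : 'M[R]_(n, d) := \matrix_(i, k) v i k.
have V0 i : row i V != 0%R.
  have [k vk] := v0 i; apply/eqP => /rowP/(_ k); rewrite !mxE; exact: vk.
have n0 : (0 < n)%N by apply/ssrnat.ltP/INR_lt; exact: n_pos n_large.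
have [T [H [x [a [k [HE HV [a0 T0] kn [ta aa]]]]]]] := gram_certificate n0 V0.
exists T; first by rewrite -card_gt0.
apply/existsP; exists H; apply/andP; split.
  rewrite inE; apply/asboolP; split; first by exists x.
  by apply: (certificate_weight n_large p_range dn a0 kn ta aa).
(* A nonzero inner product forces adjacency, and [i < j] fixes the orientation of the edge in
   [S]. *)
apply/subsetP => -[i j] yH; have := HV _ yH => /= Mij.
have lt : (i < j)%N by move: yH; rewrite HE inE => /andP[].
have ij : i != j by rewrite -val_eqE /= ltn_eqF.
have : adj S i j.
  apply: contraT => nadj; case/eqP: Mij; rewrite -[RHS](vS _ _ ij nadj) mxE.
  by apply: eq_bigr => l _; rewrite !mxE.
case/orP => // /(subsetP SE); rewrite inE /= => lt'.
by move: (ltn_trans lt lt'); rewrite ltnn.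
Qed.

(** At most n^(4t) patterns of weight at most n^(-16t) give n^(-12t), where t = [#|T|]; the exponent
    3 suffices for the sum over [T]. *)
Lemma sum_light_patterns (T : {set 'I_n * 'I_n}) :
  (\sum_(H in light_patterns T) p ^+ #|H| <= ((/ INR n) ^+ 3) ^+ #|T|)%R.
Proof.
have n2 := n_ge2; have n2N : (2 <= n)%N by apply/ssrnat.leP/(INR_le 2).
set q := / INR n.
have q0 : 0 < q by apply: Rinv_0_lt_compat; lra.
have q1 : q <= 1 by rewrite -Rinv_1; apply: Rinv_le_contravar; lra.
apply: (@le_trans _ _ (\sum_(H in light_patterns T) q ^+ (16 * #|T|))%R).
  by apply: ler_sum => H; rewrite inE => /asboolP[_ h]; apply/RleP; rewrite -!RpowE.
rewrite sumr_const -mulr_natl -INRE.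
have cT : INR #|light_patterns T| <= (INR n ^ 4) ^ #|T|.
  rewrite !RpowE !INRE -!natrX; apply/RleP; rewrite ler_nat.
  apply: leq_trans (card_gram_patterns (R := R) (T := T) _) _.
    by move=> H; rewrite inE => /asboolP[].
  have [->|t0] := posnP #|T|; first by rewrite !expn0.
  (* For [n >= 2], (n+1) n^2 + 1 <= n^4. *)
  by rewrite leq_exp2r // !expnS expn0; nia.
apply/RleP; rewrite -RmultE -!RpowE -multE pow_mult.
apply: (Rle_trans _ ((INR n ^ 4) ^ #|T| * (q ^ 16) ^ #|T|)).
  by apply: Rmult_le_compat_r cT; apply/pow_le/pow_le; lra.
rewrite -Rpow_mult_distr; apply: pow_incr.
have -> : INR n ^ 4 * q ^ 16 = q ^ 12 by rewrite /q; field; lra.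
split; first by apply: pow_le; lra.
have -> : q ^ 12 = q ^ 3 * q ^ 9 by ring.
rewrite -[X in _ <= X]Rmult_1_r; apply: Rmult_le_compat_l; first by apply: pow_le; lra.
by rewrite -(pow1 9); apply: pow_incr; lra.
Qed.

(** Summing q^|T| with q = n^-3 over nonempty position sets gives (1 + q)^(n^2) - 1; the subtracted
    1 is the term of the empty set. *)
Lemma expect_small_orth_rep :
  expect p (pairs n) (fun S => indicator
    (exists d, has_orth_rep S d /\ INR d < INR n * - ln p / (64 * ln (INR n)))) <=
  2 * / INR n.
Proof.
have n2 := n_ge2; apply: Rle_trans (pow_inv_cube_bound n2).
apply/RleP; rewrite !RpowE RminusE; set q := ((/ INR n) ^+ 3)%R.
have q0 : (0 <= q)%R by apply/RleP; rewrite /q -RpowE; apply/pow_le/Rlt_le/Rinv_0_lt_compat; lra.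
pose bad T (S : {set 'I_n * 'I_n}) := [exists H in light_patterns T, H \subset S].
apply: (@le_trans _ R (expect p (pairs n) (fun S =>
    \sum_(T : {set 'I_n * 'I_n} | T != set0) (bad T S)%:R))).
  apply: (ler_expect p01) => S SE; rewrite /indicator.
  case: asboolP => [[d [hd dn]]|_]; last by apply: sumr_ge0.
  have [T T0 hT] := light_patternsP SE hd dn.
  by rewrite (bigD1 T) //= /bad hT lerDl; apply: sumr_ge0.
rewrite expect_sum.
apply: (@le_trans _ _ (\sum_(T : {set 'I_n * 'I_n} | T != set0) q ^+ #|T|)%R).
  apply: ler_sum => T _; apply: le_trans (sum_light_patterns T).
  apply: (expect_exists_subset p01) => H; rewrite inE => /asboolP[[x ->] _].
  by apply/subsetP => y; rewrite !inE => /andP[].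
have cTT : (n * n = #|[set: 'I_n * 'I_n]|)%N by rewrite cardsT card_prod card_ord.
rewrite cTT (_ : 1 + q = (q + 1)%R) ?R1E; last exact: Rplus_comm.
rewrite -sum_subset_pow.
rewrite [X in (_ <= X - _)%R](bigD1 set0) ?sub0set //= cards0 expr0 mul1r expr1n.
rewrite [X in (_ <= X)%R]addrAC subrr add0r.
rewrite [X in (_ <= X)%R](eq_bigl (fun T : {set 'I_n * 'I_n} => T != set0)).
  by apply: ler_sum => T _; rewrite expr1n mulr1.
by move=> T; rewrite subsetT.
Qed.

Lemma expect_not_coverable : exists k : nat,
  INR k <= 400 * (INR n * - ln p) / ln (INR n) /\
  expect p (pairs n) (fun S => (~~ clique_colorable k n S)%:R%R) <= / INR n.
Proof.
have [k [k0 kK kE]] := colour_number n_large p_range.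
exists k; split=> //; apply: Rle_trans kE.
have p0 := p_pos n_large p_range; have p1 := p_lt1 p_range.
have kN : (0 < k)%N by apply/ssrnat.ltP/INR_lt.
set beta := exp _.
have b0 : (0 <= beta)%R by apply/RleP/Rlt_le/exp_pos.
apply/RleP; rewrite RmultE INRE mulr_natl.
apply: (expect_not_colorable p01 b0) => F Fn.
rewrite /beta !INRE; apply: prod_fibres_bound => //.
  by apply/RltP.
by apply/RleP/Rlt_le.
Qed.

End UnionBound.

(** * Combining the two bounds *)

Open Scope R_scope.

Theorem theorem4p1 :
  exists c C : R, 0 < c < C /\
  forall p : nat -> R,
    (exists N : nat, forall n : nat, (N <= n)%nat ->
        / INR n <= p n <= 1 - Rpower (INR n) (- (99 / 100))) ->
    Un_cv
      (fun n : nat =>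
         @gnp_prob n (p n)
           (fun S => exists d : nat, min_orth_dim S d /\
              c * (INR n * ln (/ p n)) / ln (INR n) <= INR d
              <= C * (INR n * ln (/ p n)) / ln (INR n)))
      1.
Proof.
exists (1 / 64), 400; split; first lra.
move=> p [N pN] eps eps0.
(* The first term secures the numerical estimates, the second makes the total failure probability
   3/n less than [eps]. *)
pose bound := Rmax (exp 3000000) (3 / eps).
have [M Mbound] : exists M : nat, bound < INR M.
  by have [M HM] := INR_unbounded bound; exists M.
exists (maxn N M) => n /ssrnat.leP; rewrite geq_max => /andP[Nn Mn].
have nbound : bound < INR n by apply: (Rlt_le_trans _ _ _ Mbound); apply/le_INR/ssrnat.leP.
have n_exp : exp 3000000 < INR n by apply: Rle_lt_trans nbound; apply: Rmax_l.
have n_eps : 3 / eps < INR n by apply: Rle_lt_trans nbound; apply: Rmax_r.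
have n0 : 0 < INR n by have := exp_pos 3000000; lra.
have n_large : 3000000 <= ln (INR n).
  by rewrite -[X in X <= _]ln_exp; apply/Rlt_le/ln_increasing => //; apply: exp_pos.
have p_range := pN n Nn.
have p0 := p_pos n_large p_range.
have [k [kK ekK]] := expect_not_coverable n_large p_range.
have small := expect_small_orth_rep n_large p_range.
have p01n := p01 n_large p_range.
rewrite gnp_prob_expect ln_Rinv //.
set good := fun S => _.
have upper : expect (p n) (pairs n) good <= 1.
  apply/RleP; rewrite -[leRHS](expect_cst (p n) (pairs n)).
  by apply: (ler_expect p01n) => S _; rewrite /good /indicator; case: asbool; rewrite ?lexx ?ler01.
have lower : 1 - 3 * / INR n <= expect (p n) (pairs n) good.
  (* Every graph is good, or not coverable (probability at most 1/n), or has a representation of too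
     small dimension (at most 2/n). *)
  suff : 1 <= expect (p n) (pairs n) good +
    (expect (p n) (pairs n) (fun S => (~~ clique_colorable k n S)%:R%R) +
     expect (p n) (pairs n) (fun S => indicator
       (exists d, has_orth_rep S d /\ INR d < INR n * - ln (p n) / (64 * ln (INR n))))) by lra.
  apply/RleP; rewrite !RplusE R1E -{1}(expect_cst (p n) (pairs n) 1) -!expectD.
  apply: (ler_expect p01n) => S _.
  have [kS|_] := boolP (clique_colorable k n S); last first.
    by rewrite /= /good /indicator addrCA lerDl addr_ge0.
  rewrite /= add0r /good /indicator; case: (asboolP (exists d, has_orth_rep S d /\ _)) => [_|nbad].
    by rewrite lerDr.
  rewrite addr0 asboolT //.
  have [d dmin dk] := exists_min_orth_dim (clique_cover_orth_rep kS).
  exists d; split=> //; split.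
    apply: Rnot_lt_le => lt; apply: nbad; exists d; split; first exact: (proj1 dmin).
    apply: (Rlt_le_trans _ _ _ lt); apply: Req_le; field; lra.
  by apply: Rle_trans kK; apply/le_INR/ssrnat.leP.
have ninv : 3 * / INR n < eps.
  apply: (Rmult_lt_reg_r (INR n)) => //.
  have -> : 3 * / INR n * INR n = 3 by field; lra.
  have := Rmult_lt_compat_r eps _ _ eps0 n_eps.
  by have -> : 3 / eps * eps = 3 by [field; lra]; lra.
by rewrite /R_dist Rabs_left1; lra.
Qed.
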